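(* Let $\mathfrak S$ be an operator system on $\mathbb C^d$ spanned by the pairwise products $\{M_j^*M_i\}$, $i,j\in\{1,\dots,n\}$, of $d\times d$ complex matrices $M_1,\dots,M_n$. If $\mathfrak S$ has a separating vector, then the bipartite states $\{|\psi_i\rangle=(I\otimes M_i)|\Phi\rangle\}\subseteq\mathbb C^d\otimes\mathbb C^d$ can be unambiguously distinguished using one-way LOCC.
   Context: $|\Phi\rangle=\frac1{\sqrt d}\sum_{k=0}^{d-1}|k\rangle\otimes|k\rangle\in\mathbb C^d\otimes\mathbb C^d$ is the standard maximally entangled state; the first tensor factor is Alice's system, the second is Bob's. An operator system on $\mathbb C^d$ is a linear subspace of $B(\mathbb C^d)$ that contains the identity and is closed under adjoints. A vector $|\phi\rangle\in\mathbb C^d$ is a separating vector of $\mathfrak S$ if $A|\phi\rangle\ne0$ for every nonzero $A\in\mathfrak S$. States $|\psi_1\rangle,\dots,|\psi_n\rangle$ are unambiguously distinguishable if there is a measurement protocol with $n+1$ outcomes $Y_1,\dots,Y_{n+1}$ such that for each $i\le n$ the outcome $Y_i$ occurs with positive probability and implies that the state was $|\psi_i\rangle$; the outcome $Y_{n+1}$ is the error outcome and provides no conclusive information about the identity of the state. LOCC stands for local operations and classical communication; one-way LOCC means that Alice measures first and sends her outcome to Bob, who may adapt his measurement to it. Mathematically, the measurement is of the form $\{A_k\otimes B_{k,j}\}$ with positive operators $A_k$, $B_{k,j}$ on $\mathbb C^d$ satisfying $\sum_kA_k=I$ and $\sum_jB_{k,j}=I$ for each $k$, where obtaining $A_k\otimes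 B_{k,j}$ for any $k$ is read as outcome $Y_j$.
   Formalization: The states ψ_i are additionally assumed linearly independent; without this the claim is false (e.g. M_1 = I, M_2 = Z, M_3 = (I+Z)/√2), and unambiguous distinguishability itself forces independence. *)

(* Defs.v *)
From mathcomp Require Export all_boot all_order all_algebra.
From mathcomp Require Export reals complex mxtens.

Set Implicit Arguments.
Unset Strict Implicit.
Unset Printing Implicit Defensive.

Import Order.TTheory GRing.Theory Num.Theory.
Local Open Scope ring_scope.
Local Open Scope complex_scope.
Local Open Scope sesquilinear_scope.

Section Definitions.

Variable R : realType.
Let C := R[i].

(* The order on R[i] only compares numbers with equal imaginary parts, so
   [0 <= z] forces z to be real: a matrix satisfying [psdmx] is Hermitian. *)
Definition psdmx (N : nat) (E : 'M[C]_N) : Prop :=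
  forall v : 'cV[C]_N, 0 <= (v^t* *m E *m v) 0 0.

Definition is_measurement (N m : nat) (E : 'I_m -> 'M[C]_N) : Prop :=
  (forall k, psdmx (E k)) /\ \sum_(k < m) E k = 1%:M.

(* Born rule on the ray of [psi]: [psi] need not be normalized. *)
Definition prob (N : nat) (psi : 'cV[C]_N) (E : 'M[C]_N) : C :=
  (psi^t* *m E *m psi) 0 0 / (psi^t* *m psi) 0 0.

(* The conclusive outcomes are the first n indices; [ord_max] is the error
   outcome. "Outcome i implies that the state was psi_i" means that outcome i
   has probability zero on every other state. *)
Definition unambiguous (N n : nat) (psi : 'I_n -> 'cV[C]_N)
    (Y : 'I_n.+1 -> 'M[C]_N) : Prop :=
  forall i : 'I_n,
    0 < prob (psi i) (Y (widen_ord (leqnSn n) i)) /\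
    (forall j : 'I_n, j != i ->
       prob (psi j) (Y (widen_ord (leqnSn n) i)) = 0).

(* The same outcome set 'I_n.+1 serves for every k: an outcome that Bob does
   not use after receiving k has B k j = 0. Reading A k *t B k j as outcome j
   for every k sums the operators over k. *)
Definition one_way_LOCC_unambiguously_distinguishable (d n : nat)
    (psi : 'I_n -> 'cV[C]_(d * d)) : Prop :=
  exists (m : nat) (A : 'I_m -> 'M[C]_d) (B : 'I_m -> 'I_n.+1 -> 'M[C]_d),
    [/\ is_measurement A,
        forall k, is_measurement (B k)
      & unambiguous psi (fun j => \sum_(k < m) (A k *t B k j))].

Definition ket (d : nat) (k : 'I_d) : 'cV[C]_d := delta_mx k 0.

Definition max_entangled (d : nat) : 'cV[C]_(d * d) :=
  (sqrtC d%:R)^-1 *: \sum_(k < d) (ket k *t ket k).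

Definition encoded_state (d : nat) (M : 'M[C]_d) : 'cV[C]_(d * d) :=
  (1%:M *t M) *m max_entangled d.

Definition is_operator_system (d : nat) (S : {vspace 'M[C]_d}) : Prop :=
  1%:M \in S /\ (forall A : 'M[C]_d, A \in S -> A^t* \in S).

Definition is_separating (d : nat) (S : {vspace 'M[C]_d}) (phi : 'cV[C]_d)
    : Prop :=
  forall A : 'M[C]_d, A \in S -> A != 0 -> A *m phi != 0.

End Definitions.

(* Main.v *)
(* Only one of Alice's outcomes needs to be useful. If [phi] separates [S], the
   vectors [M i *m phi] are linearly independent: a combination [X] of the [M i]
   killing [phi] gives [X^t* *m X] in [S] killing [phi], so [X = 0]. When Alice
   measures a small multiple of the rank-one operator of the conjugate of [phi],
   Bob's system is left in the state [M i *m phi], and he measures small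
   multiples of the rank-one operators of a dual family. On her other outcome
   Bob always announces the error outcome. *)
Require Import Defs.

Import Order.TTheory GRing.Theory Num.Theory.
Local Open Scope ring_scope.
Local Open Scope complex_scope.
Local Open Scope sesquilinear_scope.

Lemma conjtrmxM (F : numClosedFieldType) (m n p : nat)
    (A : 'M[F]_(m, n)) (B : 'M[F]_(n, p)) :
  (A *m B)^t* = B^t* *m A^t*.
Proof. by rewrite trmx_mul map_mxM. Qed.

Lemma conjtrmxK (F : numClosedFieldType) (m n : nat) (A : 'M[F]_(m, n)) :
  A^t*^t* = A.
Proof. by apply/matrixP => i j; rewrite !mxE conjCK. Qed.

Lemma conjtrmx_mul_self (F : numClosedFieldType) (N : nat) (v : 'cV[F]_N) :
  (v^t* *m v) 0 0 = \sum_k `|v k 0| ^+ 2.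
Proof. by rewrite mxE; apply: eq_bigr => k _; rewrite !mxE normCKC. Qed.

Lemma conjtrmx_mul_self_ge0 (F : numClosedFieldType) (N : nat) (v : 'cV[F]_N) :
  0 <= (v^t* *m v) 0 0.
Proof.
by rewrite conjtrmx_mul_self; apply: sumr_ge0 => k _; apply: exprn_ge0.
Qed.

(** Each diagonal entry of the product is the sum of the squared moduli along one column of [A], so
    it vanishes only when the whole column does. *)
Lemma conjtrmx_mul_self_eq0 (F : numClosedFieldType) (m n : nat)
    (A : 'M[F]_(m, n)) : A^t* *m A = 0 -> A = 0.
Proof.
move=> A0; apply/matrixP => k j; rewrite [RHS]mxE; apply/eqP.
have: (A^t* *m A) j j = 0 by rewrite A0 mxE.
rewrite mxE => /eqP; rewrite psumr_eq0 => [/allP/(_ k)|i _]; last first.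
  by rewrite !mxE -normCKC exprn_ge0.
by rewrite mem_index_enum !mxE -normCKC sqrf_eq0 normr_eq0 => /(_ isT).
Qed.

Lemma cauchy_schwarz_mx (F : numClosedFieldType) (N : nat) (u v : 'cV[F]_N) :
  `|(u^t* *m v) 0 0| ^+ 2 <= (u^t* *m u) 0 0 * (v^t* *m v) 0 0.
Proof.
(* [dotmx] pairs row vectors, hence the adjoints below. *)
pose dot := @spectral.dotmx F N.
have : `|dot (u^t*) (v^t*)| ^+ 2 <= dot (u^t*) (u^t*) * dot (v^t*) (v^t*).
  exact: (CauchySchwarz dot _ _).1.
by rewrite /dot !spectral.dotmxE !conjtrmxK.
Qed.

Lemma rank_one_form (F : numClosedFieldType) (N : nat) (u v : 'cV[F]_N) :
  (v^t* *m (u *m u^t*) *m v) 0 0 = `|(u^t* *m v) 0 0| ^+ 2.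
Proof.
rewrite !mulmxA -mulmxA -[X in X *m _](conjtrmxK _ _ _ (v^t* *m u)).
rewrite conjtrmxM conjtrmxK [LHS]mxE big_ord1.
by rewrite [X in X * _]mxE [X in X^* * _]mxE -normCKC.
Qed.

Section RankOneMeasurements.
Variable R : realType.

Lemma psdmx_rank_one (N : nat) (c : R[i]) (u : 'cV[R[i]]_N) :
  0 <= c -> psdmx (c *: (u *m u^t*)).
Proof.
move=> c0 v; rewrite -scalemxAr -scalemxAl mxE rank_one_form.
by rewrite mulr_ge0 ?exprn_ge0.
Qed.

(** Dividing by 1 plus the total squared norm of the [w i] keeps the sum of the rank-one operators
    below the identity, so the remainder can serve as the error outcome. The 1 keeps the divisor
    positive even when all [w i] vanish. *)
Lemma rank_one_measurement (N n : nat) (w : 'I_n -> 'cV[R[i]]_N) :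
  exists c (Y : 'I_n.+1 -> 'M[R[i]]_N),
    [/\ 0 < c, is_measurement Y
      & forall i, Y (widen_ord (leqnSn n) i) = c *: (w i *m (w i)^t*)].
Proof.
pose s := 1 + \sum_i ((w i)^t* *m w i) 0 0.
have sum_ge0 : 0 <= \sum_i ((w i)^t* *m w i) 0 0.
  by apply: sumr_ge0 => i _; apply: conjtrmx_mul_self_ge0.
have s_gt0 : 0 < s by rewrite ltr_wpDr.
pose E i := s^-1 *: (w i *m (w i)^t*).
(* [unlift ord_max] is [None] exactly at the error index, where the default of [oapp] supplies the
   remainder. *)
exists s^-1, (fun j => oapp E (1%:M - \sum_i E i) (unlift ord_max j)).
have unliftE i : unlift ord_max (widen_ord (leqnSn n) i) = Some i.
  rewrite (_ : widen_ord _ i = lift ord_max i) ?liftK //.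
  by apply: val_inj; rewrite [RHS]lift_max.
split; last by move=> i; rewrite unliftE.
  by rewrite invr_gt0.
split; last first.
  rewrite big_ord_recr /= unlift_none /=.
  by under eq_bigr do rewrite unliftE; rewrite addrC subrK.
move=> j; case: (unlift ord_max j) => [i|] /=.
  by apply: psdmx_rank_one; rewrite invr_ge0 ltW.
move=> v; rewrite mulmxBr mulmx1 mulmxBl mxE [X in _ + X]mxE subr_ge0.
(* After clearing [s], its summand 1 contributes a nonnegative term to drop; the rest is
   Cauchy-Schwarz for each [w i]. *)
rewrite -scaler_sumr -scalemxAr -scalemxAl mxE ler_pdivrMl //.
rewrite mulmx_sumr mulmx_suml summxE mulrDl mul1r mulr_suml.
apply: ler_wpDl; first exact: conjtrmx_mul_self_ge0.
by apply: ler_sum => i _; rewrite rank_one_form cauchy_schwarz_mx.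
Qed.

End RankOneMeasurements.

Lemma tensmxZZ (F : comPzRingType) (m n p q : nat) (a b : F)
    (A : 'M[F]_(m, n)) (B : 'M[F]_(p, q)) :
  (a *: A) *t (b *: B) = (a * b) *: (A *t B).
Proof. by apply/matrixP => i j; rewrite !mxE mulrACA. Qed.

Lemma conjtrmx_tens (F : numClosedFieldType) (m n p q : nat)
    (A : 'M[F]_(m, n)) (B : 'M[F]_(p, q)) :
  (A *t B)^t* = A^t* *t B^t*.
Proof. by rewrite trmx_tens map_mxT. Qed.

Section EncodedStates.
Variables (R : realType) (d : nat).

Lemma encoded_state_sum (n : nat) (c : 'I_n -> R[i]) (M : 'I_n -> 'M[R[i]]_d) :
  encoded_state (\sum_i c i *: M i) = \sum_i c i *: encoded_state (M i).
Proof.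
rewrite /encoded_state.
under [RHS]eq_bigr do rewrite scalemxAl.
rewrite -mulmx_suml; congr (_ *m _).
apply/matrixP => i j; rewrite mxE !summxE mulr_sumr.
by apply: eq_bigr => k _; rewrite !mxE mulrCA.
Qed.

(* Conjugating Alice's vector is what turns the pairing with the maximally
   entangled state into [M] acting on [phi]. *)
Lemma encoded_state_overlap (M : 'M[R[i]]_d) (phi w : 'cV[R[i]]_d) :
  ((map_mx Num.conj phi *t w)^t* *m encoded_state M) 0 0 =
  (sqrtC d%:R)^-1 * (w^t* *m (M *m phi)) 0 0.
Proof.
rewrite /encoded_state /max_entangled conjtrmx_tens mulmxA tensmx_mul mulmx1.
rewrite -scalemxAr mxE; congr (_ * _).
(* In the standard basis, [phi] matches the sum defining the maximally entangled state term by
   term. *)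
have phiE : phi = \sum_k phi k 0 *: ket R k.
  by rewrite [LHS]matrix_sum_delta; apply: eq_bigr => k _; rewrite big_ord1.
rewrite [in RHS]phiE !mulmx_sumr !summxE; apply: eq_bigr => k _.
rewrite (tensmx_mul _ _ (ket R k) (ket R k)) -!scalemxAr mulmxA.
rewrite mxE [RHS]mxE !ord1; congr (_ * _).
rewrite mxE (bigD1 k) //= big1 ?addr0; first by rewrite !mxE conjCK !eqxx mulr1.
by move=> l /negPf lk; rewrite !mxE lk mulr0.
Qed.

End EncodedStates.

(** With the vectors as rows of a matrix, independence yields a right inverse, whose conjugated
    columns are the dual vectors. *)
Lemma free_dual_family (F : numClosedFieldType) (N n : nat)
    (x : 'I_n -> 'cV[F]_N) :
  (forall c : 'I_n -> F, \sum_i c i *: x i = 0 -> forall i, c i = 0) ->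
  exists w : 'I_n -> 'cV[F]_N,
    forall i j, ((w i)^t* *m x j) 0 0 = (i == j)%:R.
Proof.
move=> x_free; pose V := \matrix_(i < n, k < N) x i k 0.
have /row_freeP [W VW] : row_free V.
  apply: inj_row_free => v vV0; apply/rowP => i; rewrite [RHS]mxE.
  apply: (x_free (v 0)); apply/colP => k.
  have := congr1 (fun r : 'rV_N => r 0 k) vV0; rewrite !mxE => <-.
  by rewrite summxE; apply: eq_bigr => j _; rewrite !mxE.
exists (fun i => map_mx Num.conj (col i W)) => i j.
have := congr1 (fun A : 'M_n => A j i) VW; rewrite !mxE eq_sym => <-.
by apply: eq_bigr => k _; rewrite !mxE conjCK mulrC.
Qed.

Theorem theorem2 (R : realType) (d n : nat) (hd : (0 < d)%N)
    (M : 'I_n -> 'M[R[i]]_d) (S : {vspace 'M[R[i]]_d})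
    (hS : is_operator_system S)
    (hspan : S = <<[seq (M j)^t* *m M i | i <- enum 'I_n, j <- enum 'I_n]>>%VS)
    (hindep : free [tuple encoded_state (M i) | i < n])
    (hsep : exists phi : 'cV[R[i]]_d, is_separating S phi) :
  one_way_LOCC_unambiguously_distinguishable (fun i => encoded_state (M i)).
Proof.
case: hsep => phi phi_sep.
have [c cM0 i|w w_dual] := @free_dual_family _ _ _ (fun i => M i *m phi).
  pose X := \sum_i c i *: M i.
  have Xphi0 : X *m phi = 0.
    by rewrite -cM0 mulmx_suml; apply: eq_bigr => k _; rewrite scalemxAl.
  (* Expanding both factors gives a combination of the generators [(M j)^t* *m M k]. *)
  have XX_in : X^t* *m X \in S.
    rewrite mulmx_sumr; apply: memv_suml => k _.
    rewrite -scalemxAr memvZ // linear_sum /= map_mx_sum mulmx_suml.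
    apply: memv_suml => j _; rewrite linearZ /= map_mxZ -scalemxAl memvZ //.
    rewrite hspan memv_span //; apply/allpairsP.
    by exists (k, j); rewrite !mem_enum.
  have X0 : X = 0.
    apply: conjtrmx_mul_self_eq0; apply/eqP/negPn/negP => XX_neq0.
    by have := phi_sep _ XX_in XX_neq0; rewrite -mulmxA Xphi0 mulmx0 eqxx.
  (* [X = 0] says that the encoded states satisfy the linear relation with coefficients [c]. *)
  apply: (freeP hindep).
  under eq_bigr do rewrite -tnth_nth tnth_mktuple.
  rewrite -encoded_state_sum -/X X0.
  by rewrite /encoded_state (tensmx0 1%:M) mul0mx.
have [a [A [a_gt0 A_meas AE]]] :=
  rank_one_measurement R d 1 (fun=> map_mx Num.conj phi).
have [b [B [b_gt0 B_meas BE]]] := rank_one_measurement R d n w.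
(* Zero vectors make every conclusive operator of [B'] zero, leaving only the error outcome. *)
have [e [B' [_ B'_meas B'E]]] := rank_one_measurement R d n (fun=> 0).
exists 2, A, (fun k => if k == ord_max then B' else B); split => //.
  by move=> k; case: ifP.
(* Only Alice's outcome 0 contributes; there the form is a scaled squared overlap, which duality
   reduces to a Kronecker delta. *)
have YE i j : ((encoded_state (M j))^t* *m
    (\sum_(k < 2) A k *t
       (if k == ord_max then B' else B) (widen_ord (leqnSn n) i)) *m
    encoded_state (M j)) 0 0 =
    a * b * `|(sqrtC d%:R)^-1 * (i == j)%:R| ^+ 2.
  rewrite big_ord_recr big_ord1 eqxx B'E mul0mx scaler0 tensmx0 /= addr0.
  rewrite AE BE tensmxZZ -tensmx_mul -conjtrmx_tens.
  rewrite -scalemxAr -scalemxAl mxE rank_one_form encoded_state_overlap.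
  by rewrite w_dual.
move=> i; split=> [|j ji]; rewrite /prob YE; last first.
  by rewrite eq_sym (negPf ji) mulr0 normr0 expr0n mulr0 mul0r.
have YE_gt0 : 0 < a * b * `|(sqrtC d%:R)^-1 * (i == i)%:R| ^+ 2 :> R[i].
  rewrite eqxx mulr1 (mulr_gt0 (mulr_gt0 a_gt0 b_gt0)) // exprn_gt0 //.
  by rewrite normr_gt0 invr_eq0 sqrtC_eq0 pnatr_eq0 -lt0n.
rewrite divr_gt0 // lt_def conjtrmx_mul_self_ge0 andbT.
(* A zero squared norm would make the state vanish, and with it the positive numerator. *)
apply: contraTneq YE_gt0 => psi0; rewrite -YE.
have -> : encoded_state (M i) = 0; last by rewrite mulmx0 mxE ltxx.
by apply: conjtrmx_mul_self_eq0; apply/matrixP => k l; rewrite !ord1 psi0 mxE.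
Qed.
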